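(* Let $R>0$ and $\theta\in(0,\pi/2)$ be fixed. Let $\boldsymbol f=(f_1,f_2)$ be a vector field in $\mathbb{R}^2$ with components in $C_0^\infty(\mathbb{R}^2)$ which are supported in $\mathbb{D}_{R\sin\theta}$. Then $\boldsymbol f$ is uniquely determined by the knowledge of $\mathcal{L}\boldsymbol f(\beta,d)$ and $\mathcal{T}\boldsymbol f(\beta,d)$ for all $d\in[0,2R]$ and $\beta\in[0,2\pi)$. That is, if $\boldsymbol f$ and $\boldsymbol g$ are two such vector fields with $\mathcal{L}\boldsymbol f(\beta,d)=\mathcal{L}\boldsymbol g(\beta,d)$ and $\mathcal{T}\boldsymbol f(\beta,d)=\mathcal{T}\boldsymbol g(\beta,d)$ for all $\beta\in[0,2\pi)$ and $d\in[0,2R]$, then $\boldsymbol f=\boldsymbol g$.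
   Context: For $\rho>0$, $\mathbb{D}_\rho$ denotes the disk of radius $\rho$ centered at the origin of $\mathbb{R}^2$. The angle $\theta\in(0,\pi/2)$ is fixed. $C_0^\infty(U)$ denotes smooth (scalar) functions with compact support in $U$; vector fields supported in a disk are extended by zero to all of $\mathbb{R}^2$. For $\beta\in[0,2\pi)$ put $\boldsymbol x_\beta=(R\cos\beta,R\sin\beta)$, $\boldsymbol u_\beta=-(\cos\beta,\sin\beta)$, $\boldsymbol v_\beta=-(\cos(\theta+\beta),\sin(\theta+\beta))$. For a vector $\boldsymbol w=(w_1,w_2)$ let $\boldsymbol w^\perp=(-w_2,w_1)$, so $\boldsymbol u_\beta^\perp=(\sin\beta,-\cos\beta)$ and $\boldsymbol v_\beta^\perp=(\sin(\theta+\beta),-\cos(\theta+\beta))$. For a vector field $\boldsymbol f=(f_1,f_2)$ with components in $C_0^\infty(\mathbb{D}_R)$, the longitudinal V-line transform and the transverse V-line transform are, for $\beta\in[0,2\pi)$ and $d\in[0,2R]$, $$\mathcal{L}\boldsymbol f(\beta,d)=\int_0^d \boldsymbol u_\beta\cdot\boldsymbol f(\boldsymbol x_\beta+s\boldsymbol u_\beta)\,ds+\int_0^\infty \boldsymbol v_\beta\cdot\boldsymbol f(\boldsymbol x_\beta+d\boldsymbol u_\beta+s\boldsymbol v_\beta)\,ds,$$ $$\mathcal{T}\boldsymbol f(\beta,d)=\int_0^d \boldsymbol u_\beta^\perp\cdot\boldsymbol f(\boldsymbol x_\beta+s\boldsymbol u_\beta)\,ds+\int_0^\infty \boldsymbol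 v_\beta^\perp\cdot\boldsymbol f(\boldsymbol x_\beta+d\boldsymbol u_\beta+s\boldsymbol v_\beta)\,ds.$$ *)

(* Defs.v *)
From Stdlib Require Import Reals List.
From Coquelicot Require Import Coquelicot.
Open Scope R_scope.

Definition closure (A : R * R -> Prop) (p : R * R) : Prop :=
  forall U : R * R -> Prop, locally p U -> exists q, U q /\ A q.

(* Coquelicot has no compactness predicate on the plane, and Stdlib's [compact]
   only concerns subsets of the line. *)
Definition compact2 (K : R * R -> Prop) : Prop :=
  forall (I : Type) (U : I -> R * R -> Prop),
    (forall i, open (U i)) ->
    (forall p, K p -> exists i, U i p) ->
    exists l : list I, forall p, K p -> exists i, In i l /\ U i p.

Definition support (h : R * R -> R) : R * R -> Prop :=
  closure (fun p => h p <> 0).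

(* [ex_diff_n h n x y] says that all iterated partial derivatives of order at
   most [n] exist at (x,y) and are continuous there; required at every point
   and for every [n], this is the class C^infinity of the plane. *)
Definition smooth (h : R * R -> R) : Prop :=
  forall (n : nat) (x y : R), ex_diff_n (fun a b => h (a, b)) n x y.

Definition Cc_infty (h : R * R -> R) : Prop :=
  smooth h /\ compact2 (support h).

Definition disk (rho : R) (p : R * R) : Prop :=
  sqrt (fst p ^ 2 + snd p ^ 2) < rho.

Definition dot (v w : R * R) : R := fst v * fst w + snd v * snd w.

Definition perp (w : R * R) : R * R := (- snd w, fst w).

Definition x_pt (Rad beta : R) : R * R := (Rad * cos beta, Rad * sin beta).
Definition u_dir (beta : R) : R * R := (- cos beta, - sin beta).
Definition v_dir (theta beta : R) : R * R :=
  (- cos (theta + beta), - sin (theta + beta)).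

(* [RInt] and [RInt_gen] are total; the integrals below genuinely exist when
   the components of [f] are continuous with compact support. *)
Definition L_transform (Rad theta : R) (f : R * R -> R * R) (beta d : R) : R :=
  let x := x_pt Rad beta in
  let u := u_dir beta in
  let v := v_dir theta beta in
  RInt (fun s => dot u (f (plus x (scal s u)))) 0 d
  + RInt_gen (fun s => dot v (f (plus (plus x (scal d u)) (scal s v))))
      (at_point 0) (Rbar_locally p_infty).

Definition T_transform (Rad theta : R) (f : R * R -> R * R) (beta d : R) : R :=
  let x := x_pt Rad beta in
  let u := u_dir beta in
  let v := v_dir theta beta in
  RInt (fun s => dot (perp u) (f (plus x (scal s u)))) 0 d
  + RInt_gen (fun s => dot (perp v) (f (plus (plus x (scal d u)) (scal s v))))
      (at_point 0) (Rbar_locally p_infty).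

Definition admissible_field (rho : R) (f : R * R -> R * R) : Prop :=
  Cc_infty (fun p => fst (f p)) /\ Cc_infty (fun p => snd (f p)) /\
  (forall p, support (fun q => fst (f q)) p -> disk rho p) /\
  (forall p, support (fun q => snd (f q)) p -> disk rho p).

(* Main.v *)
Require Import Defs.
From Stdlib Require Import Reals List Lra.
From Coquelicot Require Import Coquelicot.
Open Scope R_scope.

(** By linearity it suffices to treat the difference [h] of the two fields,
    whose transforms both vanish.

    From V-lines to lines.  Let [A] be the vector integral of [h] along the
    radial branch and [B] the one along the reflected branch.  The longitudinal
    and transverse data together say that [u.A + v.B = 0] and
    [u^perp.A + v^perp.B = 0].  The V-lines entering at the antipodal boundary
    points [x_beta] and [x_(beta+PI)] can be given the same vertex
    [r (cos beta, sin beta)]; their branches then point in opposite directions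
    and subtracting the relations replaces [A] by the integral [P] over a whole
    diameter, which does not depend on [r], and [B] by the integral [Q(r)] over
    the whole line through the vertex in direction [v_beta].  For [r = R] this
    line is at distance [R sin theta] from the origin and misses the support, so
    [Q(R) = 0].  Since a vector is determined by its components along a unit
    vector and its rotate, [P = 0], and then [Q(r) = 0] for every [r]
    ([full_lines_vanish]).  The distance of these lines to the origin is
    [|r| sin theta], so they include all lines that meet the support: both
    components of [h] have vanishing integrals over all non-vertical lines
    ([slope_lines_vanish]).

    From lines to points.  For a scalar [H] put
    [S_k(m,c) = int t^k H(t, m t + c) dt].  Differentiating under the integral,
    [d/dm S_k = int t^(k+1) (D_2 H)(t, m t + c) dt = d/dc S_(k+1)].  So if [S_k]
    is identically zero then [S_(k+1)] is constant in [c], hence zero because the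
    line misses the support when [c] is large.  As [S_0 = 0], all [S_k] vanish
    ([slope_moments_vanish]).  For [m = 0] this says that every horizontal slice
    of [H] has all its moments equal to zero, and a continuous function on an
    interval with this property is zero ([vanishing_moments]). *)

(** * Integrals of continuous functions *)

(** Integrands of [RInt] live in a normed module whose carrier unfolds to [R];
    [ring] and [lra] need the equation at type [R] itself. *)
Ltac as_R := match goal with |- @eq _ ?x ?y => change (@eq R x y) end.

Lemma continuous_Rmult (f g : R -> R) (t : R) :
  continuous f t -> continuous g t -> continuous (fun s => f s * g s) t.
Proof. exact (continuous_mult f g t). Qed.

Lemma continuous_pow (k : nat) (f : R -> R) (t : R) :
  continuous f t -> continuous (fun s => f s ^ k) t.
Proof.
  intros Hf; induction k as [|k IH]; simpl.
  - apply continuous_const.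
  - now apply continuous_Rmult.
Qed.

Lemma ex_RInt_continuous_R (f : R -> R) (a b : R) :
  (forall t, continuous f t) -> ex_RInt f a b.
Proof. intros Hf; apply (ex_RInt_continuous (V := R_CompleteNormedModule)); auto. Qed.

Lemma RInt_lincomb (f g : R -> R) (x y a b : R) :
  (forall t, continuous f t) -> (forall t, continuous g t) ->
  RInt (fun t => x * f t + y * g t) a b = x * RInt f a b + y * RInt g a b.
Proof.
  intros Hf Hg.
  apply is_RInt_unique.
  apply (is_RInt_plus (V := R_NormedModule) (fun t => x * f t) (fun t => y * g t));
    apply (is_RInt_scal (V := R_NormedModule)).
  - apply (RInt_correct (V := R_CompleteNormedModule)); now apply ex_RInt_continuous_R.
  - apply (RInt_correct (V := R_CompleteNormedModule)); now apply ex_RInt_continuous_R.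
Qed.

Lemma RInt_split (f : R -> R) (a b c : R) :
  (forall t, continuous f t) -> RInt f a b + RInt f b c = RInt f a c.
Proof.
  intros Hf; apply (RInt_Chasles (V := R_CompleteNormedModule));
    now apply ex_RInt_continuous_R.
Qed.

Lemma RInt_lower_bound (f : R -> R) (a b c : R) :
  a <= b -> (forall t, continuous f t) -> (forall t, a < t < b -> c <= f t) ->
  (b - a) * c <= RInt f a b.
Proof.
  intros Hab Hf Hc.
  rewrite <- (RInt_const (V := R_CompleteNormedModule) a b c : _ = (b - a) * c).
  apply RInt_le; auto.
  - apply ex_RInt_const.
  - now apply ex_RInt_continuous_R.
Qed.

Lemma RInt_eq_zero (f : R -> R) (a b : R) :
  (forall t, Rmin a b < t < Rmax a b -> f t = 0) -> RInt f a b = 0.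
Proof.
  intros H.
  rewrite (RInt_ext f (fun _ => 0)) by exact H.
  rewrite (RInt_const (V := R_CompleteNormedModule) a b 0).
  apply Rmult_0_r.
Qed.

(** * A continuous function with vanishing moments is zero *)

(** The statement ranges over all moments at once, so that each further factor
    [p + q t + r t^2] only shifts the moment used from the induction
    hypothesis. *)
Lemma quadratic_power_moments (phi : R -> R) (a b p q r : R) :
  (forall t, continuous phi t) ->
  (forall k, RInt (fun t => t ^ k * phi t) a b = 0) ->
  forall n k, RInt (fun t => t ^ k * (phi t * (p + q * t + r * t ^ 2) ^ n)) a b = 0.
Proof.
  intros Hphi Hmom n; induction n as [|n IH]; intros k.
  - rewrite <- (Hmom k); apply RInt_ext; intros t _; simpl; as_R; ring.
  - set (F := fun j t => t ^ j * (phi t * (p + q * t + r * t ^ 2) ^ n)) in IH.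
    assert (HF : forall j t, continuous (F j) t).
    { intros j t; unfold F.
      apply continuous_Rmult; [apply continuous_pow, continuous_id|].
      apply continuous_Rmult; [apply Hphi|].
      apply continuous_pow, (ex_derive_continuous (V := R_NormedModule)).
      auto_derive; auto. }
    rewrite (RInt_ext _ (fun t => 1 * (p * F k t + q * F (S k) t) + r * F (S (S k)) t)).
    2: { intros t _; unfold F; simpl; ring. }
    rewrite RInt_lincomb, RInt_lincomb; auto.
    + unfold F; rewrite !IH; as_R; ring.
    + intros t; apply (continuous_plus (V := R_NormedModule) (fun t => p * F k t));
        apply continuous_Rmult; auto using continuous_const.
Qed.

(** If [phi t0 > 0], then [phi] is bounded below by [eta > 0] at distance at most
    [del] from [t0].  The quadratic [Q] with maximum at [t0] and
    [Q = 1] at distance [del] has values in [[0,1]] farther away, and values at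
    least [q > 1] within [del / 2].  Hence [int phi Q^n] is at least
    [del eta q^n] minus a constant; it is zero because [Q^n] is a polynomial, and
    [q^n] is unbounded. *)
Lemma nonpos_of_vanishing_moments (phi : R -> R) (a b t0 : R) :
  (forall t, continuous phi t) ->
  (forall k, RInt (fun t => t ^ k * phi t) a b = 0) ->
  a < t0 < b -> phi t0 <= 0.
Proof.
  intros Hphi Hmom Ht0.
  destruct (Rle_or_lt (phi t0) 0) as [|Hpos]; [assumption|exfalso].
  set (eta := phi t0 / 2).
  assert (Heta : 0 < eta) by (unfold eta; lra).
  destruct (proj1 (filterlim_locally phi (phi t0)) (Hphi t0) (mkposreal eta Heta))
    as [del0 Hdel0].
  set (del := Rmin (del0 / 2) (Rmin (t0 - a) (b - t0))).
  assert (Hdel : 0 < del /\ del < del0 /\ del <= t0 - a /\ del <= b - t0).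
  { pose proof (cond_pos del0).
    pose proof (Rmin_l (del0 / 2) (Rmin (t0 - a) (b - t0))).
    pose proof (Rmin_r (del0 / 2) (Rmin (t0 - a) (b - t0))).
    pose proof (Rmin_l (t0 - a) (b - t0)).
    pose proof (Rmin_r (t0 - a) (b - t0)).
    assert (0 < del) by (unfold del; repeat apply Rmin_glb_lt; lra).
    unfold del in *; lra. }
  assert (Hnear : forall t, Rabs (t - t0) <= del -> eta <= phi t).
  { intros t Ht.
    assert (B : Rabs (phi t - phi t0) < eta).
    { apply Hdel0; change (Rabs (t - t0) < del0); lra. }
    apply Rabs_def2 in B; unfold eta in *; lra. }
  destruct (continuity_ab_min phi a b ltac:(lra)
              (fun c _ => proj2 (continuity_pt_filterlim phi c) (Hphi c))) as [tm [Hmin _]].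
  set (C := Rabs (phi tm)).
  assert (HC : forall t, a <= t <= b -> - C <= phi t).
  { intros t Ht; specialize (Hmin t Ht).
    unfold C; pose proof (Rle_abs (- phi tm)) as A; rewrite Rabs_Ropp in A; lra. }
  assert (HC0 : 0 <= C) by apply Rabs_pos.
  (* [L] bounds [|t - t0|] on the interval, which keeps [Q] nonnegative there. *)
  set (L := b - a).
  assert (HL : 0 < L) by (unfold L; lra).
  set (c := / L ^ 2).
  assert (Hc : 0 < c) by (apply Rinv_0_lt_compat, pow_lt; lra).
  assert (HcL : c * L ^ 2 = 1) by (unfold c; field; lra).
  set (Q := fun t => (1 + c * (del ^ 2 - t0 ^ 2)) + (2 * c * t0) * t + (- c) * t ^ 2).
  assert (HQ : forall t, Q t = 1 + c * (del ^ 2 - (t - t0) ^ 2)).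
  { intros t; unfold Q; ring. }
  assert (HQpos : forall t, a <= t <= b -> 0 <= Q t).
  { intros t Ht; rewrite HQ.
    assert ((t - t0) ^ 2 <= L ^ 2) by (unfold L; nra).
    assert (c * (t - t0) ^ 2 <= c * L ^ 2) by (apply Rmult_le_compat_l; lra).
    assert (0 <= c * del ^ 2) by (apply Rmult_le_pos; nra).
    lra. }
  set (q := 1 + c * (3 / 4 * del ^ 2)).
  assert (Hq : 1 < q).
  { unfold q; assert (0 < c * (3 / 4 * del ^ 2)); [|lra].
    apply Rmult_lt_0_compat; nra. }
  assert (Hcont : forall n t, continuous (fun t => phi t * Q t ^ n) t).
  { intros n t; apply continuous_Rmult; [apply Hphi|].
    apply continuous_pow, (ex_derive_continuous (V := R_NormedModule)).
    unfold Q; auto_derive; auto. }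
  assert (Hlow : forall n t, a <= t <= b -> - C <= phi t * Q t ^ n).
  { intros n t Ht.
    pose proof (pow_le _ n (HQpos t Ht)) as Hpow.
    destruct (Rle_or_lt (Rabs (t - t0)) del) as [Hn|Hf].
    - specialize (Hnear t Hn).
      assert (0 <= phi t * Q t ^ n) by (apply Rmult_le_pos; lra). lra.
    - assert (HQ1 : Q t <= 1).
      { rewrite HQ.
        assert (del ^ 2 <= (t - t0) ^ 2).
        { rewrite <- (pow2_abs (t - t0)); nra. }
        nra. }
      assert (Q t ^ n <= 1).
      { rewrite <- (pow1 n); apply pow_incr; auto. }
      specialize (HC t Ht). nra. }
  assert (Hhigh : forall n t, Rabs (t - t0) <= del / 2 -> eta * q ^ n <= phi t * Q t ^ n).
  { intros n t Ht.
    assert (eta <= phi t) by (apply Hnear; lra).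
    assert (Hqt : q <= Q t).
    { rewrite HQ; unfold q.
      apply Rplus_le_compat_l, Rmult_le_compat_l; [lra|].
      rewrite <- (pow2_abs (t - t0)).
      pose proof (Rabs_pos (t - t0)); nra. }
    assert (q ^ n <= Q t ^ n) by (apply pow_incr; lra).
    assert (0 <= q ^ n) by (apply pow_le; lra).
    apply Rmult_le_compat; lra. }
  assert (Hbound : forall n, del * eta * q ^ n <= L * C).
  { intros n.
    assert (E : RInt (fun t => phi t * Q t ^ n) a b = 0).
    { rewrite <- (quadratic_power_moments phi a b (1 + c * (del ^ 2 - t0 ^ 2)) (2 * c * t0)
                    (- c) Hphi Hmom n 0).
      apply RInt_ext; intros t _; simpl; unfold Q; simpl; ring. }
    rewrite <- (RInt_split _ a (t0 - del / 2) b) in E by apply Hcont.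
    rewrite <- (RInt_split _ (t0 - del / 2) (t0 + del / 2) b) in E by apply Hcont.
    assert (I1 := RInt_lower_bound (fun t => phi t * Q t ^ n) a (t0 - del / 2) (- C)
              ltac:(lra) (Hcont n) ltac:(intros; apply Hlow; lra)).
    assert (I2 := RInt_lower_bound (fun t => phi t * Q t ^ n)
              (t0 - del / 2) (t0 + del / 2) (eta * q ^ n)
              ltac:(lra) (Hcont n)
              ltac:(intros; apply Hhigh, Rabs_le; lra)).
    assert (I3 := RInt_lower_bound (fun t => phi t * Q t ^ n) (t0 + del / 2) b (- C)
              ltac:(lra) (Hcont n) ltac:(intros; apply Hlow; lra)).
    unfold L; nra. }
  destruct (Pow_x_infinity q ltac:(rewrite Rabs_pos_eq; lra) (L * C / (del * eta) + 1))
    as [N HN].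
  specialize (HN N (le_n N)).
  rewrite Rabs_pos_eq in HN by (apply pow_le; lra).
  specialize (Hbound N).
  assert (0 < del * eta) by (apply Rmult_lt_0_compat; lra).
  assert (del * eta * (L * C / (del * eta) + 1) <= del * eta * q ^ N)
    by (apply Rmult_le_compat_l; lra).
  replace (del * eta * (L * C / (del * eta) + 1)) with (L * C + del * eta) in * by (field; lra).
  lra.
Qed.

Lemma vanishing_moments (phi : R -> R) (a b : R) :
  (forall t, continuous phi t) ->
  (forall k, RInt (fun t => t ^ k * phi t) a b = 0) ->
  forall t, a < t < b -> phi t = 0.
Proof.
  intros Hphi Hmom t Ht.
  assert (phi t <= 0) by (eapply nonpos_of_vanishing_moments; eauto).
  assert (- phi t <= 0); [|lra].
  apply (nonpos_of_vanishing_moments (fun t => - phi t) a b); auto.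
  - intros s; apply (continuous_opp (V := R_NormedModule)); auto.
  - intros k.
    rewrite (RInt_ext _ (fun t => (- 1) * (t ^ k * phi t) + 0 * (t ^ k * phi t))).
    2: { intros s _; as_R; ring. }
    assert (forall s, continuous (fun t => t ^ k * phi t) s).
    { intros s; apply continuous_Rmult; auto; apply continuous_pow, continuous_id. }
    rewrite RInt_lincomb by auto. rewrite Hmom; as_R; ring.
Qed.

(** * Functions of the plane with vanishing line integrals *)

Definition jointly_continuous (H : R -> R -> R) : Prop :=
  forall x y, continuous (fun z : R * R => H (fst z) (snd z)) (x, y).

Lemma jointly_continuous_comp {U : UniformSpace} (H : R -> R -> R) (f g : U -> R) (s : U) :
  jointly_continuous H -> continuous f s -> continuous g s ->
  continuous (fun z => H (f z) (g z)) s.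
Proof. intros HH Hf Hg; apply (continuous_comp_2 f g H); auto. Qed.

Definition vanishes_outside (rho : R) (H : R -> R -> R) : Prop :=
  forall x y, rho ^ 2 <= x ^ 2 + y ^ 2 -> H x y = 0.

Lemma vanishes_left (rho : R) (H : R -> R -> R) (x y : R) :
  0 <= rho -> vanishes_outside rho H -> rho <= Rabs x -> H x y = 0.
Proof.
  intros Hr HH Hx; apply HH; rewrite <- (pow2_abs x).
  pose proof (pow2_ge_0 y).
  assert (rho ^ 2 <= Rabs x ^ 2) by (apply pow_incr; lra). lra.
Qed.

Lemma vanishes_right (rho : R) (H : R -> R -> R) (x y : R) :
  0 <= rho -> vanishes_outside rho H -> rho <= Rabs y -> H x y = 0.
Proof.
  intros Hr HH Hx; apply HH; rewrite <- (pow2_abs y).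
  pose proof (pow2_ge_0 x).
  assert (rho ^ 2 <= Rabs y ^ 2) by (apply pow_incr; lra). lra.
Qed.

(** The differentiability in one direction that suffices to differentiate
    integrals over non-vertical lines with respect to slope and intercept. *)
Definition C1_in_y (H : R -> R -> R) : Prop :=
  jointly_continuous H /\
  exists D, jointly_continuous D /\ forall x y, is_derive (fun v => H x v) y (D x y).

Definition lincomb (x y : R) (F G : R -> R -> R) : R -> R -> R :=
  fun u v => x * F u v + y * G u v.

Lemma jointly_continuous_lincomb (x y : R) (F G : R -> R -> R) :
  jointly_continuous F -> jointly_continuous G -> jointly_continuous (lincomb x y F G).
Proof.
  intros HF HG u v.
  apply (continuous_plus (V := R_NormedModule) (fun z : R * R => x * F (fst z) (snd z)));
    apply (continuous_scal_r (K := R_AbsRing) (V := R_NormedModule)); auto.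
Qed.

Lemma C1_in_y_lincomb (x y : R) (F G : R -> R -> R) :
  C1_in_y F -> C1_in_y G -> C1_in_y (lincomb x y F G).
Proof.
  intros [HF (DF & HDF & EF)] [HG (DG & HDG & EG)]; split.
  - now apply jointly_continuous_lincomb.
  - exists (lincomb x y DF DG); split; [now apply jointly_continuous_lincomb|].
    intros u v; apply (is_derive_plus (V := R_NormedModule) (fun w => x * F u w));
      now apply is_derive_scal.
Qed.

Lemma vanishes_outside_lincomb (rho x y : R) (F G : R -> R -> R) :
  vanishes_outside rho F -> vanishes_outside rho G ->
  vanishes_outside rho (lincomb x y F G).
Proof.
  intros HF HG u v Huv; unfold lincomb; rewrite (HF _ _ Huv), (HG _ _ Huv); ring.
Qed.

Lemma continuous_affine (m c t : R) : continuous (fun t => m * t + c) t.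
Proof. apply (ex_derive_continuous (V := R_NormedModule)); auto_derive; auto. Qed.

(** The lines [z |-> (t |-> z * w t + o t)] cover both variations needed below:
    [w t = t] with constant [o] varies the slope, and [w t = 1] with
    [o t = m t] varies the intercept. *)
Lemma is_derive_line_integral (H D : R -> R -> R) (w o : R -> R) (k : nat) (rho z : R) :
  jointly_continuous H -> jointly_continuous D ->
  (forall x y, is_derive (fun v => H x v) y (D x y)) ->
  (forall t, continuous o t) -> (forall t, continuous w t) ->
  is_derive (fun z => RInt (fun t => t ^ k * H t (z * w t + o t)) (- rho) rho) z
    (RInt (fun t => t ^ k * (w t * D t (z * w t + o t))) (- rho) rho).
Proof.
  intros HH HD Hder Ho Hw.
  assert (HDer : forall u t, is_derive (fun z => t ^ k * H t (z * w t + o t)) u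
                     (t ^ k * (w t * D t (u * w t + o t)))).
  { intros u t.
    apply (is_derive_scal (fun z => H t (z * w t + o t))).
    apply (is_derive_comp (fun v => H t v) (fun z => z * w t + o t)).
    - apply Hder.
    - auto_derive; auto; ring. }
  rewrite (RInt_ext _ (fun t => Derive (fun z => t ^ k * H t (z * w t + o t)) z)).
  2: { intros t _; symmetry; apply is_derive_unique, HDer. }
  apply is_derive_RInt_param.
  - apply filter_forall; intros u t _; eexists; apply HDer.
  - intros t _.
    apply (continuity_2d_pt_ext (fun u t => t ^ k * (w t * D t (u * w t + o t)))).
    { intros u v; symmetry; apply is_derive_unique, HDer. }
    apply continuity_2d_pt_filterlim.
    assert (Hs : continuous (fun z : R * R => snd z) (z, t)) by apply continuous_snd.
    assert (Hws : continuous (fun z : R * R => w (snd z)) (z, t)).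
    { apply (continuous_comp (fun z : R * R => snd z) w); auto. }
    apply (continuous_mult (K := R_AbsRing) (fun z : R * R => snd z ^ k)
             (fun z : R * R => w (snd z) * D (snd z) (fst z * w (snd z) + o (snd z)))).
    + apply (continuous_comp (fun z : R * R => snd z) (fun s => s ^ k)); auto.
      apply continuous_pow, continuous_id.
    + apply (continuous_mult (K := R_AbsRing) (fun z : R * R => w (snd z))
             (fun z : R * R => D (snd z) (fst z * w (snd z) + o (snd z)))); auto.
      apply jointly_continuous_comp; auto.
      apply (continuous_plus (V := R_NormedModule) (fun z : R * R => fst z * w (snd z))).
      * apply (continuous_mult (K := R_AbsRing) (fun z : R * R => fst z)); auto.
        apply continuous_fst.
      * apply (continuous_comp (fun z : R * R => snd z) o); auto.
  - apply filter_forall; intros u.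
    apply ex_RInt_continuous_R; intros t.
    apply continuous_Rmult; [apply continuous_pow, continuous_id|].
    apply jointly_continuous_comp; auto using continuous_id.
    apply (continuous_plus (V := R_NormedModule) (fun t => u * w t)); auto.
    apply continuous_Rmult; auto using continuous_const.
Qed.

(** Induction on [k] through [d/dm S_k = d/dc S_(k+1)], where [S_k (m,c)] is the
    integral in the conclusion. *)
Lemma slope_moments_vanish (H D : R -> R -> R) (rho : R) :
  0 < rho -> jointly_continuous H -> jointly_continuous D ->
  (forall x y, is_derive (fun v => H x v) y (D x y)) ->
  vanishes_outside rho H ->
  (forall m c, RInt (fun t => H t (m * t + c)) (- rho) rho = 0) ->
  forall k m c, RInt (fun t => t ^ k * H t (m * t + c)) (- rho) rho = 0.
Proof.
  intros Hrho HH HD Hder Hout Hlines k; induction k as [|k IH]; intros m c.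
  - rewrite <- (Hlines m c); apply RInt_ext; intros t _; simpl; as_R; ring.
  - assert (Hz : forall c, RInt (fun t => t ^ S k * D t (m * t + c)) (- rho) rho = 0).
    { intros c'.
      assert (E := is_derive_line_integral H D (fun t => t) (fun _ => c') k rho m HH HD Hder
                     (fun t => continuous_const c' t) continuous_id).
      rewrite (RInt_ext _ (fun t => t ^ k * (t * D t (m * t + c')))).
      2: { intros t _; simpl; as_R; ring. }
      rewrite <- (is_derive_unique _ _ _ E).
      rewrite (Derive_ext _ (fun _ => 0)); [apply Derive_const|].
      intros z; apply IH. }
    (* For this intercept the line stays above height [rho] over [[-rho,rho]]. *)
    set (c1 := Rabs c + Rabs m * rho + rho + 1).
    assert (Hc1 : c < c1 /\ Rabs m * rho + rho <= c1).
    { pose proof (Rabs_pos c); pose proof (Rle_abs c).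
      assert (0 <= Rabs m * rho) by (apply Rmult_le_pos; [apply Rabs_pos|lra]).
      unfold c1; lra. }
    rewrite (eq_is_derive (V := R_NormedModule)
               (fun c => RInt (fun t => t ^ S k * H t (m * t + c)) (- rho) rho) c c1).
    + apply RInt_eq_zero; intros t Ht.
      rewrite Rmin_left, Rmax_right in Ht by lra.
      rewrite (vanishes_right rho H); [apply Rmult_0_r|lra|assumption|].
      apply Rle_trans with (m * t + c1); [|apply Rle_abs].
      assert (Rabs (m * t) <= Rabs m * rho).
      { rewrite Rabs_mult; apply Rmult_le_compat_l; [apply Rabs_pos|apply Rabs_le; lra]. }
      pose proof (Rle_abs (- (m * t))) as A; rewrite Rabs_Ropp in A; lra.
    + intros c' _.
      assert (E := is_derive_line_integral H D (fun _ => 1) (fun t => m * t) (S k) rho c' HH HD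
                     Hder ltac:(intros t; apply (ex_derive_continuous (V := R_NormedModule)); auto_derive; auto)
                     (fun t => continuous_const 1 t)).
      rewrite (RInt_ext (fun t => t ^ S k * (1 * D t (c' * 1 + m * t)))
                 (fun t => t ^ S k * D t (m * t + c'))) in E.
      2: { intros t _; replace (c' * 1 + m * t) with (m * t + c') by ring; as_R; ring. }
      rewrite Hz in E.
      eapply is_derive_ext; [|exact E].
      intros z; apply RInt_ext; intros t _.
      now replace (z * 1 + m * t) with (m * t + z) by ring.
    + lra.
Qed.

(** A uniqueness theorem for the Radon transform; the moments of the slice at
    height [y] come from the horizontal line [m = 0, c = y]. *)
Lemma zero_of_vanishing_line_integrals (H : R -> R -> R) (rho : R) :
  0 < rho -> C1_in_y H ->
  vanishes_outside rho H ->
  (forall m c, RInt (fun t => H t (m * t + c)) (- rho) rho = 0) ->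
  forall x y, H x y = 0.
Proof.
  intros Hrho (HH & D & HD & Hder) Hout Hlines x y.
  destruct (Rle_or_lt rho (Rabs x)) as [Hx|Hx].
  { apply (vanishes_left rho); auto; lra. }
  apply Rabs_def2 in Hx.
  apply (vanishing_moments (fun t => H t y) (- rho) rho); [| |lra].
  - intros t; apply jointly_continuous_comp; auto using continuous_id, continuous_const.
  - intros k; rewrite <- (slope_moments_vanish H D rho Hrho HH HD Hder Hout Hlines k 0 y).
    apply RInt_ext; intros t _; now replace (0 * t + y) with y by ring.
Qed.

(** * Integrals over intervals that contain the support *)

Lemma RInt_enlarge (g : R -> R) (a b a' b' : R) :
  (forall t, continuous g t) -> a' <= a -> a <= b -> b <= b' ->
  (forall t, t <= a \/ b <= t -> g t = 0) ->
  RInt g a' b' = RInt g a b.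
Proof.
  intros Hg Ha Hab Hb Hz.
  rewrite <- (RInt_split g a' a b') by auto.
  rewrite <- (RInt_split g a b b') by auto.
  rewrite (RInt_eq_zero g a' a), (RInt_eq_zero g b b').
  - as_R; ring.
  - intros t Ht; rewrite Rmin_left, Rmax_right in Ht by lra; apply Hz; lra.
  - intros t Ht; rewrite Rmin_left, Rmax_right in Ht by lra; apply Hz; lra.
Qed.

Lemma RInt_window (g : R -> R) (a b a' b' : R) :
  (forall t, continuous g t) -> a <= b -> a' <= b' ->
  (forall t, t <= a \/ b <= t -> g t = 0) ->
  (forall t, t <= a' \/ b' <= t -> g t = 0) ->
  RInt g a b = RInt g a' b'.
Proof.
  intros Hg Hab Hab' Hz Hz'.
  pose proof (Rmin_l a a'); pose proof (Rmin_r a a').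
  pose proof (Rmax_l b b'); pose proof (Rmax_r b b').
  rewrite <- (RInt_enlarge g a b (Rmin a a') (Rmax b b')) by auto.
  now apply RInt_enlarge.
Qed.

Lemma RInt_gen_half_line (g : R -> R) (N : R) :
  0 <= N -> (forall t, continuous g t) -> (forall t, N <= t -> g t = 0) ->
  RInt_gen g (at_point 0) (Rbar_locally p_infty) = RInt g 0 N.
Proof.
  intros HN Hg Hz.
  apply (is_RInt_gen_unique (V := R_CompleteNormedModule)).
  intros P HP.
  apply (Filter_prod _ _ _ (fun a => a = 0) (fun b => N < b)).
  - reflexivity.
  - now exists N.
  - intros a b -> Hb; exists (RInt g 0 N); split.
    + simpl.
      replace (RInt g 0 N) with (RInt g 0 b).
      * apply (RInt_correct (V := R_CompleteNormedModule)); now apply ex_RInt_continuous_R.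
      * rewrite <- (RInt_split g 0 N b) by auto.
        rewrite (RInt_eq_zero g N b); [as_R; ring|].
        intros t Ht; rewrite Rmin_left in Ht by lra; apply Hz; lra.
    + now apply locally_singleton.
Qed.

Lemma RInt_affine (g : R -> R) (k o a b : R) :
  (forall t, continuous g t) ->
  k * RInt (fun s => g (k * s + o)) a b = RInt g (k * a + o) (k * b + o).
Proof.
  intros Hg.
  rewrite <- (RInt_comp_lin (V := R_CompleteNormedModule) g k o a b)
    by now apply ex_RInt_continuous_R.
  symmetry; apply (RInt_scal (V := R_CompleteNormedModule)).
  apply ex_RInt_continuous_R; intros t.
  apply (continuous_comp (fun s => k * s + o) g); auto using continuous_affine.
Qed.

Lemma RInt_reflect (g : R -> R) (a b : R) :
  (forall t, continuous g t) -> RInt (fun s => g (- s)) a b = RInt g (- b) (- a).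
Proof.
  intros Hg.
  assert (E := RInt_affine g (-1) 0 a b Hg).
  rewrite (RInt_ext _ (fun s => g (- s))) in E
    by (intros s _; f_equal; as_R; ring).
  replace (-1 * a + 0) with (- a) in E by ring.
  replace (-1 * b + 0) with (- b) in E by ring.
  assert (S := RInt_split g (- a) (- b) (- a) Hg).
  rewrite (RInt_point (V := R_CompleteNormedModule)) in S.
  change (RInt g (- a) (- b) + RInt g (- b) (- a) = 0) in S. lra.
Qed.

(** * V-line transforms as integrals over segments *)

Definition line_integral (H : R -> R -> R) (p w : R * R) (a b : R) : R :=
  RInt (fun s => H (fst p + s * fst w) (snd p + s * snd w)) a b.

Lemma continuous_along_line (H : R -> R -> R) (p w : R * R) (t : R) :
  jointly_continuous H ->
  continuous (fun s => H (fst p + s * fst w) (snd p + s * snd w)) t.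
Proof.
  intros HH; apply jointly_continuous_comp; auto;
    apply (ex_derive_continuous (V := R_NormedModule)); auto_derive; auto.
Qed.

Lemma line_integral_lincomb (F G : R -> R -> R) (x y : R) (p w : R * R) (a b : R) :
  jointly_continuous F -> jointly_continuous G ->
  line_integral (lincomb x y F G) p w a b =
  x * line_integral F p w a b + y * line_integral G p w a b.
Proof.
  intros HF HG.
  apply (RInt_lincomb
           (fun s => F (fst p + s * fst w) (snd p + s * snd w))
           (fun s => G (fst p + s * fst w) (snd p + s * snd w)));
    intros t; now apply continuous_along_line.
Qed.

Definition comp1 (f : R * R -> R * R) (x y : R) : R := fst (f (x, y)).
Definition comp2 (f : R * R -> R * R) (x y : R) : R := snd (f (x, y)).

(** A point at distance at least [2 rad] from a point of the disk of radius [rad]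
    is outside this open disk.  The computation completes the square: the squared norm
    is [(s + i)^2 + j^2] with [i], [j] the coordinates of [p] along and across
    [w]. *)
Lemma far_point_bound (p w : R * R) (rad s : R) :
  0 <= rad -> fst p ^ 2 + snd p ^ 2 <= rad ^ 2 -> fst w ^ 2 + snd w ^ 2 = 1 ->
  2 * rad <= Rabs s ->
  rad ^ 2 <= (fst p + s * fst w) ^ 2 + (snd p + s * snd w) ^ 2.
Proof.
  destruct p as [p1 p2], w as [w1 w2]; simpl fst; simpl snd; intros Hr Hp Hw Hs.
  set (i := p1 * w1 + p2 * w2).
  assert (Hi : i ^ 2 <= rad ^ 2).
  { assert (i ^ 2 + (p1 * w2 - p2 * w1) ^ 2 = (p1 ^ 2 + p2 ^ 2) * (w1 ^ 2 + w2 ^ 2))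
      by (unfold i; ring).
    rewrite Hw in *. pose proof (pow2_ge_0 (p1 * w2 - p2 * w1)). lra. }
  assert (E : (p1 + s * w1) ^ 2 + (p2 + s * w2) ^ 2 =
              (s + i) ^ 2 + (p1 * w2 - p2 * w1) ^ 2).
  { transitivity (p1 ^ 2 + p2 ^ 2 + 2 * s * i + s ^ 2 * (w1 ^ 2 + w2 ^ 2));
      [unfold i; ring|].
    assert (i ^ 2 + (p1 * w2 - p2 * w1) ^ 2 = (p1 ^ 2 + p2 ^ 2) * (w1 ^ 2 + w2 ^ 2))
      by (unfold i; ring).
    rewrite Hw in *; lra. }
  rewrite E.
  assert (- rad <= i <= rad) by (split; nra).
  assert (rad ^ 2 <= (s + i) ^ 2).
  { destruct (Rle_or_lt 0 s).
    - rewrite Rabs_pos_eq in Hs by lra; apply pow_incr; lra.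
    - rewrite Rabs_left in Hs by lra.
      replace ((s + i) ^ 2) with ((- s - i) ^ 2) by ring; apply pow_incr; lra. }
  pose proof (pow2_ge_0 (p1 * w2 - p2 * w1)); lra.
Qed.

(** The weights [a] and [b] are arbitrary so that both transforms are instances:
    [(u, v)] for the longitudinal one and [(perp u, perp v)] for the transverse
    one. *)
Lemma vline_as_line_integrals (f : R * R -> R * R) (rho rad d : R) (x u v a b : R * R) :
  0 <= rho <= rad ->
  jointly_continuous (comp1 f) -> jointly_continuous (comp2 f) ->
  vanishes_outside rho (comp1 f) -> vanishes_outside rho (comp2 f) ->
  fst (plus x (scal d u)) ^ 2 + snd (plus x (scal d u)) ^ 2 <= rad ^ 2 ->
  fst v ^ 2 + snd v ^ 2 = 1 ->
  RInt (fun s => dot a (f (plus x (scal s u)))) 0 d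
  + RInt_gen (fun s => dot b (f (plus (plus x (scal d u)) (scal s v))))
      (at_point 0) (Rbar_locally p_infty) =
  (fst a * line_integral (comp1 f) x u 0 d + snd a * line_integral (comp2 f) x u 0 d)
  + (fst b * line_integral (comp1 f) (plus x (scal d u)) v 0 (2 * rad)
     + snd b * line_integral (comp2 f) (plus x (scal d u)) v 0 (2 * rad)).
Proof.
  intros Hrho C1 C2 V1 V2 Hy Hv.
  set (y := plus x (scal d u)) in *.
  assert (Cd : forall (c p w : R * R) (t : R),
             continuous (fun s : R => dot c (f (plus p (scal (s : R_Ring) w)))) t).
  { intros c p w t.
    apply (continuous_plus (V := R_NormedModule)
             (fun s => fst c * comp1 f (fst p + s * fst w) (snd p + s * snd w))
             (fun s => snd c * comp2 f (fst p + s * fst w) (snd p + s * snd w)));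
      apply continuous_Rmult; auto using continuous_const, continuous_along_line. }
  rewrite (RInt_gen_half_line _ (2 * rad)).
  - unfold line_integral.
    rewrite <- !RInt_lincomb by (intros; now apply continuous_along_line).
    reflexivity.
  - lra.
  - apply Cd.
  - intros s Hs.
    assert (far : rho ^ 2 <= (fst y + s * fst v) ^ 2 + (snd y + s * snd v) ^ 2).
    { apply Rle_trans with (rad ^ 2); [apply pow_incr; lra|].
      apply far_point_bound; auto; [lra|]. pose proof (Rle_abs s); lra. }
    change (fst b * comp1 f (fst y + s * fst v) (snd y + s * snd v)
            + snd b * comp2 f (fst y + s * fst v) (snd y + s * snd v) = 0).
    rewrite (V1 _ _ far), (V2 _ _ far); ring.
Qed.

Definition incoming (Rad : R) (H : R -> R -> R) (beta d : R) : R :=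
  line_integral H (x_pt Rad beta) (u_dir beta) 0 d.

(** The vertex is in the disk of radius [Rad], so by [far_point_bound] the branch has
    left this disk for good after length [2 * Rad]. *)
Definition outgoing (Rad theta : R) (H : R -> R -> R) (beta d : R) : R :=
  line_integral H (plus (x_pt Rad beta) (scal d (u_dir beta))) (v_dir theta beta)
    0 (2 * Rad).

Lemma cos2_sin2 (a : R) : cos a ^ 2 + sin a ^ 2 = 1.
Proof. pose proof (sin2_cos2 a); unfold Rsqr in *; nra. Qed.

Lemma v_dir_unit (theta beta : R) : fst (v_dir theta beta) ^ 2 + snd (v_dir theta beta) ^ 2 = 1.
Proof. simpl; pose proof (cos2_sin2 (theta + beta)); nra. Qed.

Lemma u_dir_unit (beta : R) : fst (u_dir beta) ^ 2 + snd (u_dir beta) ^ 2 = 1.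
Proof. simpl; pose proof (cos2_sin2 beta); nra. Qed.

Lemma vertex_on_diameter (Rad beta d : R) :
  plus (x_pt Rad beta) (scal (d : R_Ring) (u_dir beta)) =
  ((Rad - d) * cos beta, (Rad - d) * sin beta).
Proof.
  change ((Rad * cos beta + d * - cos beta, Rad * sin beta + d * - sin beta) =
          ((Rad - d) * cos beta, (Rad - d) * sin beta)).
  f_equal; ring.
Qed.

Lemma vertex_in_disk (Rad beta d : R) :
  0 <= d <= 2 * Rad ->
  fst (plus (x_pt Rad beta) (scal (d : R_Ring) (u_dir beta))) ^ 2
  + snd (plus (x_pt Rad beta) (scal (d : R_Ring) (u_dir beta))) ^ 2 <= Rad ^ 2.
Proof.
  intros Hd; rewrite vertex_on_diameter; simpl fst; simpl snd.
  rewrite !Rpow_mult_distr, <- Rmult_plus_distr_l, cos2_sin2; nra.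
Qed.

Lemma admissible_radius (Rad theta : R) :
  0 < Rad -> 0 < theta < PI / 2 -> 0 < Rad * sin theta /\ Rad * sin theta < Rad.
Proof.
  intros HR Hth.
  assert (0 < sin theta) by (apply sin_gt_0; lra).
  assert (sin theta < 1) by (rewrite <- sin_PI2; apply sin_increasing_1; lra).
  split; nra.
Qed.

Lemma L_transform_as_branches (rho Rad theta : R) (f : R * R -> R * R) (beta d : R) :
  0 <= rho <= Rad ->
  jointly_continuous (comp1 f) -> jointly_continuous (comp2 f) ->
  vanishes_outside rho (comp1 f) -> vanishes_outside rho (comp2 f) ->
  0 <= d <= 2 * Rad ->
  L_transform Rad theta f beta d =
  dot (u_dir beta) (incoming Rad (comp1 f) beta d, incoming Rad (comp2 f) beta d)
  + dot (v_dir theta beta)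
      (outgoing Rad theta (comp1 f) beta d, outgoing Rad theta (comp2 f) beta d).
Proof.
  intros Hrho C1 C2 V1 V2 Hd.
  apply (vline_as_line_integrals f rho Rad d (x_pt Rad beta) (u_dir beta) (v_dir theta beta));
    auto using vertex_in_disk, v_dir_unit.
Qed.

Lemma T_transform_as_branches (rho Rad theta : R) (f : R * R -> R * R) (beta d : R) :
  0 <= rho <= Rad ->
  jointly_continuous (comp1 f) -> jointly_continuous (comp2 f) ->
  vanishes_outside rho (comp1 f) -> vanishes_outside rho (comp2 f) ->
  0 <= d <= 2 * Rad ->
  T_transform Rad theta f beta d =
  dot (perp (u_dir beta)) (incoming Rad (comp1 f) beta d, incoming Rad (comp2 f) beta d)
  + dot (perp (v_dir theta beta))
      (outgoing Rad theta (comp1 f) beta d, outgoing Rad theta (comp2 f) beta d).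
Proof.
  intros Hrho C1 C2 V1 V2 Hd.
  apply (vline_as_line_integrals f rho Rad d (x_pt Rad beta) (u_dir beta) (v_dir theta beta));
    auto using vertex_in_disk, v_dir_unit.
Qed.

(** * Combining opposite V-lines into full lines *)

Definition on_diameter (beta r : R) : R * R := (r * cos beta, r * sin beta).

(** Both segments lie on the diameter at angle [beta] and meet at the common vertex
    [r (cos beta, sin beta)]. *)
Lemma incoming_opposite (Rad : R) (H : R -> R -> R) (beta r : R) :
  jointly_continuous H ->
  incoming Rad H beta (Rad - r) + incoming Rad H (beta + PI) (Rad + r) =
  line_integral H (0, 0) (cos beta, sin beta) (- Rad) Rad.
Proof.
  intros HH.
  set (g := fun t => H (0 + t * cos beta) (0 + t * sin beta)).
  assert (Hg : forall t, continuous g t).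
  { intros t; exact (continuous_along_line H (0, 0) (cos beta, sin beta) t HH). }
  assert (E1 := RInt_affine g (-1) Rad 0 (Rad - r) Hg).
  assert (E2 := RInt_affine g 1 (- Rad) 0 (Rad + r) Hg).
  rewrite (RInt_ext _ (fun s => H (fst (x_pt Rad beta) + s * fst (u_dir beta))
                                  (snd (x_pt Rad beta) + s * snd (u_dir beta)))) in E1
    by (intros s _; unfold g; simpl; f_equal; as_R; ring).
  rewrite (RInt_ext _ (fun s => H (fst (x_pt Rad (beta + PI)) + s * fst (u_dir (beta + PI)))
                                  (snd (x_pt Rad (beta + PI)) + s * snd (u_dir (beta + PI)))))
    in E2
    by (intros s _; unfold g; simpl; rewrite neg_cos, neg_sin; f_equal; as_R; ring).
  fold (line_integral H (x_pt Rad beta) (u_dir beta) 0 (Rad - r)) in E1.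
  fold (line_integral H (x_pt Rad (beta + PI)) (u_dir (beta + PI)) 0 (Rad + r)) in E2.
  fold (incoming Rad H beta (Rad - r)) in E1.
  fold (incoming Rad H (beta + PI) (Rad + r)) in E2.
  replace (-1 * 0 + Rad) with Rad in E1 by ring.
  replace (-1 * (Rad - r) + Rad) with r in E1 by ring.
  replace (1 * 0 + - Rad) with (- Rad) in E2 by ring.
  replace (1 * (Rad + r) + - Rad) with r in E2 by ring.
  change (line_integral H (0, 0) (cos beta, sin beta) (- Rad) Rad) with (RInt g (- Rad) Rad).
  assert (S1 := RInt_split g (- Rad) r Rad Hg).
  assert (S2 := RInt_split g (- Rad) Rad r Hg).
  lra.
Qed.

Lemma outgoing_opposite (Rad theta : R) (H : R -> R -> R) (beta r : R) :
  jointly_continuous H ->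
  outgoing Rad theta H beta (Rad - r) + outgoing Rad theta H (beta + PI) (Rad + r) =
  line_integral H (on_diameter beta r) (v_dir theta beta) (- (2 * Rad)) (2 * Rad).
Proof.
  intros HH.
  set (p := on_diameter beta r); set (v := v_dir theta beta).
  set (g := fun s => H (fst p + s * fst v) (snd p + s * snd v)).
  assert (Hg : forall t, continuous g t) by (intros t; now apply continuous_along_line).
  assert (E1 : outgoing Rad theta H beta (Rad - r) = RInt g 0 (2 * Rad)).
  { apply RInt_ext; intros s _; unfold g, p, v; simpl.
    unfold plus, scal, mult; simpl; unfold mult; simpl; f_equal; ring. }
  assert (E2 : outgoing Rad theta H (beta + PI) (Rad + r) = RInt (fun s => g (- s)) 0 (2 * Rad)).
  { apply RInt_ext; intros s _; unfold g, p, v; simpl.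
    unfold plus, scal, mult; simpl; unfold mult; simpl.
    replace (theta + (beta + PI)) with (theta + beta + PI) by ring.
    rewrite !neg_cos, !neg_sin; f_equal; ring. }
  rewrite E1, E2, RInt_reflect by auto.
  rewrite Ropp_0, Rplus_comm; now apply RInt_split.
Qed.

Definition zero_data (Rad theta : R) (H1 H2 : R -> R -> R) : Prop :=
  forall beta d, 0 <= beta < 2 * PI -> 0 <= d <= 2 * Rad ->
    let A := (incoming Rad H1 beta d, incoming Rad H2 beta d) in
    let B := (outgoing Rad theta H1 beta d, outgoing Rad theta H2 beta d) in
    dot (u_dir beta) A + dot (v_dir theta beta) B = 0 /\
    dot (perp (u_dir beta)) A + dot (perp (v_dir theta beta)) B = 0.

Lemma zero_of_rotated_zero (w q : R * R) :
  fst w ^ 2 + snd w ^ 2 = 1 -> dot w q = 0 -> dot (perp w) q = 0 -> q = (0, 0).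
Proof.
  destruct w as [w1 w2], q as [q1 q2]; unfold dot, perp; simpl; intros Hw E1 E2.
  f_equal.
  - transitivity (q1 * (w1 * (w1 * 1) + w2 * (w2 * 1))); [rewrite Hw; ring|].
    transitivity (w1 * (w1 * q1 + w2 * q2) - w2 * (- w2 * q1 + w1 * q2)); [ring|].
    rewrite E1, E2; ring.
  - transitivity (q2 * (w1 * (w1 * 1) + w2 * (w2 * 1))); [rewrite Hw; ring|].
    transitivity (w2 * (w1 * q1 + w2 * q2) + w1 * (- w2 * q1 + w1 * q2)); [ring|].
    rewrite E1, E2; ring.
Qed.

(** The line through the boundary point in direction [v] makes the angle [theta] with
    the radius, so its distance to the origin is [Rad sin theta]. *)
Lemma boundary_line_misses_disk (Rad theta beta s : R) :
  (Rad * sin theta) ^ 2 <=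
  (fst (on_diameter beta Rad) + s * fst (v_dir theta beta)) ^ 2
  + (snd (on_diameter beta Rad) + s * snd (v_dir theta beta)) ^ 2.
Proof.
  simpl fst; simpl snd; rewrite cos_plus, sin_plus.
  pose proof (cos2_sin2 beta) as Hb; pose proof (cos2_sin2 theta) as Ht.
  match goal with |- _ <= ?r => replace r with
    ((Rad ^ 2 + s ^ 2 * (cos theta ^ 2 + sin theta ^ 2) - 2 * Rad * s * cos theta)
     * (cos beta ^ 2 + sin beta ^ 2)) by ring end.
  rewrite Hb.
  pose proof (pow2_ge_0 (s - Rad * cos theta)).
  replace (Rad ^ 2) with (Rad ^ 2 * (cos theta ^ 2 + sin theta ^ 2)) by (rewrite Ht; ring).
  rewrite Ht in *; nra.
Qed.

Definition full_line (Rad theta : R) (H : R -> R -> R) (beta r : R) : R :=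
  line_integral H (on_diameter beta r) (v_dir theta beta) (- (2 * Rad)) (2 * Rad).

Definition lines_through_diameters_vanish (Rad theta : R) (H : R -> R -> R) : Prop :=
  forall beta r, 0 <= beta < PI -> - Rad <= r <= Rad -> full_line Rad theta H beta r = 0.

(** The vertex [r = Rad] gives the vanishing of the diameter integral [P], and with
    it every other [r] gives the vanishing of the integral over the full line. *)
Lemma full_lines_vanish (Rad theta : R) (H1 H2 : R -> R -> R) :
  0 < Rad -> jointly_continuous H1 -> jointly_continuous H2 ->
  vanishes_outside (Rad * sin theta) H1 -> vanishes_outside (Rad * sin theta) H2 ->
  zero_data Rad theta H1 H2 ->
  lines_through_diameters_vanish Rad theta H1 /\
  lines_through_diameters_vanish Rad theta H2.
Proof.
  intros HRad C1 C2 V1 V2 Hdata.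
  enough (K : forall beta r, 0 <= beta < PI -> - Rad <= r <= Rad ->
            full_line Rad theta H1 beta r = 0 /\ full_line Rad theta H2 beta r = 0)
    by (split; intros beta r Hb Hr; now destruct (K beta r Hb Hr)).
  intros beta r Hbeta.
  set (P := (line_integral H1 (0, 0) (cos beta, sin beta) (- Rad) Rad,
             line_integral H2 (0, 0) (cos beta, sin beta) (- Rad) Rad)).
  assert (Hsum : forall r, - Rad <= r <= Rad ->
            let Q := (full_line Rad theta H1 beta r, full_line Rad theta H2 beta r) in
            dot (u_dir beta) P + dot (v_dir theta beta) Q = 0 /\
            dot (perp (u_dir beta)) P + dot (perp (v_dir theta beta)) Q = 0).
  { intros s Hs Q; unfold P, Q, full_line; clear P Q.
    destruct (Hdata beta (Rad - s)) as [L1 T1]; [lra|lra|].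
    destruct (Hdata (beta + PI) (Rad + s)) as [L2 T2]; [lra|lra|].
    rewrite <- !(incoming_opposite Rad _ beta s), <- !(outgoing_opposite Rad theta _ beta s)
      by assumption.
    unfold dot, perp, u_dir, v_dir in *; simpl in *.
    replace (theta + (beta + PI)) with (theta + beta + PI) in * by ring.
    rewrite !neg_cos, !neg_sin in *; lra. }
  assert (Hedge : full_line Rad theta H1 beta Rad = 0 /\ full_line Rad theta H2 beta Rad = 0).
  { split; apply RInt_eq_zero; intros s _; [apply V1|apply V2];
      apply boundary_line_misses_disk. }
  destruct Hedge as [e1 e2].
  assert (HP : P = (0, 0)).
  { destruct (Hsum Rad) as [L T]; [lra|].
    rewrite e1, e2 in L, T.
    apply (zero_of_rotated_zero (u_dir beta)); [apply u_dir_unit| |];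
      [rewrite <- L|rewrite <- T]; unfold dot; simpl; ring. }
  intros Hr.
  destruct (Hsum r Hr) as [L T]; rewrite HP in L, T.
  assert (HQ : (full_line Rad theta H1 beta r, full_line Rad theta H2 beta r) = (0, 0)).
  { apply (zero_of_rotated_zero (v_dir theta beta)); [apply v_dir_unit| |];
      [rewrite <- L|rewrite <- T]; unfold dot; simpl; ring. }
  now injection HQ.
Qed.


Lemma line_integral_reverse (H : R -> R -> R) (p w : R * R) (a : R) :
  jointly_continuous H ->
  line_integral H p (- fst w, - snd w) (- a) a = line_integral H p w (- a) a.
Proof.
  intros HH.
  assert (E := RInt_reflect (fun s => H (fst p + s * fst w) (snd p + s * snd w)) (- a) a
                 (fun t => continuous_along_line H p w t HH)).
  rewrite Ropp_involutive in E.
  unfold line_integral; rewrite <- E.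
  apply RInt_ext; intros s _; simpl; f_equal; ring.
Qed.

(** * All non-vertical lines *)

(** Directions [v_beta] with [beta] in [[0,PI)] cover all unoriented directions; the
    representative at [alpha - theta] outside this range is shifted by [PI], which
    reverses both the line and the diameter. *)
Lemma oblique_lines_vanish (Rad theta : R) (H : R -> R -> R) :
  0 < theta < PI / 2 -> jointly_continuous H ->
  lines_through_diameters_vanish Rad theta H ->
  forall alpha r, - (PI / 2) < alpha < PI / 2 -> - Rad <= r <= Rad ->
    line_integral H (on_diameter (alpha - theta) r) (cos alpha, sin alpha)
      (- (2 * Rad)) (2 * Rad) = 0.
Proof.
  intros Hth HH Hl alpha r Ha Hr.
  destruct (Rle_or_lt 0 (alpha - theta)) as [Hb|Hb].
  - assert (E := Hl (alpha - theta) r ltac:(lra) Hr).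
    unfold full_line, v_dir in E; replace (theta + (alpha - theta)) with alpha in E by ring.
    rewrite <- E; symmetry.
    exact (line_integral_reverse H _ (cos alpha, sin alpha) _ HH).
  - assert (E := Hl (alpha - theta + PI) (- r) ltac:(lra) ltac:(lra)).
    unfold full_line, v_dir, on_diameter in E.
    replace (theta + (alpha - theta + PI)) with (alpha + PI) in E by ring.
    rewrite !neg_cos, !neg_sin, !Ropp_involutive, !Rmult_opp_opp in E.
    exact E.
Qed.

(** The line [y = m x + c] has angle [alpha = atan m] and signed distance
    [c cos alpha] to the origin.  If its absolute value exceeds [Rad sin theta] the
    line misses the support; otherwise the line crosses the diameter at angle [alpha - theta] at
    [r = - c cos alpha / sin theta], which is in [[-Rad,Rad]]. *)
Lemma slope_lines_vanish (Rad theta : R) (H : R -> R -> R) :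
  0 < Rad -> 0 < theta < PI / 2 -> jointly_continuous H ->
  vanishes_outside (Rad * sin theta) H ->
  lines_through_diameters_vanish Rad theta H ->
  forall m c, RInt (fun t => H t (m * t + c)) (- (Rad * sin theta)) (Rad * sin theta) = 0.
Proof.
  intros HRad Hth HH HV Hl m c.
  set (rho := Rad * sin theta) in *.
  assert (Hsin : 0 < sin theta) by (apply sin_gt_0; lra).
  assert (Hrho : 0 < rho < Rad) by now apply admissible_radius.
  destruct (atan_bound m) as [Ha1 Ha2].
  set (alpha := atan m) in *.
  assert (Hcos : 0 < cos alpha) by (apply cos_gt_0; lra).
  assert (Hm : m * cos alpha = sin alpha).
  { rewrite <- (tan_atan m) at 1; fold alpha; unfold tan; field; lra. }
  destruct (Rle_or_lt (Rabs (c * cos alpha)) rho) as [Hc|Hc].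
  - set (r := - (c * cos alpha) / sin theta).
    assert (Hrs : r * sin theta = - (c * cos alpha)) by (unfold r; field; lra).
    assert (Hr : - Rad <= r <= Rad).
    { apply Rabs_le_between in Hc; unfold rho in Hc.
      split; apply (Rmult_le_reg_r (sin theta)); lra. }
    set (p := on_diameter (alpha - theta) r).
    assert (Hp : m * fst p + c = snd p).
    { apply (Rmult_eq_reg_r (cos alpha)); [|lra].
      replace ((m * fst p + c) * cos alpha) with (m * cos alpha * fst p + c * cos alpha) by ring.
      rewrite Hm; unfold p; simpl; rewrite cos_minus, sin_minus.
      pose proof (cos2_sin2 alpha) as Hcs.
      replace (c * cos alpha) with (- (r * sin theta) * (cos alpha ^ 2 + sin alpha ^ 2))
        by (rewrite Hcs; lra).
      ring. }
    set (g := fun t => H t (m * t + c)).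
    assert (Hg : forall t, continuous g t).
    { intros t; apply jointly_continuous_comp; auto using continuous_id, continuous_affine. }
    assert (E := RInt_affine g (cos alpha) (fst p) (- (2 * Rad)) (2 * Rad) Hg).
    assert (Hgs : forall s, g (cos alpha * s + fst p) =
                       H (fst p + s * cos alpha) (snd p + s * sin alpha)).
    { intros s; unfold g; rewrite <- Hp, <- Hm; f_equal; ring. }
    rewrite (RInt_ext _ (fun s => H (fst p + s * cos alpha) (snd p + s * sin alpha))) in E
      by (intros s _; apply Hgs).
    assert (Z : RInt (fun s => H (fst p + s * cos alpha) (snd p + s * sin alpha))
                  (- (2 * Rad)) (2 * Rad) = 0).
    { apply (oblique_lines_vanish Rad theta H Hth HH Hl alpha r); [lra|exact Hr]. }
    rewrite Z, Rmult_0_r in E.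
    etransitivity; [|symmetry; exact E].
    apply RInt_window; auto; [lra|nra| |].
    + intros t Ht; apply (vanishes_left rho); auto; [lra|].
      destruct Ht; [rewrite Rabs_left by lra|rewrite Rabs_pos_eq by lra]; lra.
    + intros t Ht.
      replace t with (cos alpha * ((t - fst p) / cos alpha) + fst p) by (field; lra).
      set (s := (t - fst p) / cos alpha).
      assert (Hs : cos alpha * s = t - fst p) by (unfold s; field; lra).
      rewrite Hgs; apply HV.
      apply Rle_trans with (Rad ^ 2); [apply pow_incr; lra|].
      apply (far_point_bound p (cos alpha, sin alpha)); [lra| |apply cos2_sin2|].
      * unfold p; simpl fst; simpl snd; pose proof (cos2_sin2 (alpha - theta)) as E2.
        replace ((r * cos (alpha - theta)) ^ 2 + (r * sin (alpha - theta)) ^ 2)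
          with (r ^ 2 * (cos (alpha - theta) ^ 2 + sin (alpha - theta) ^ 2)) by ring.
        rewrite E2; nra.
      * destruct Ht.
        -- assert (s <= - (2 * Rad)) by (apply (Rmult_le_reg_l (cos alpha)); lra).
           rewrite Rabs_left; lra.
        -- assert (2 * Rad <= s) by (apply (Rmult_le_reg_l (cos alpha)); lra).
           rewrite Rabs_pos_eq; lra.
  - apply RInt_eq_zero; intros t _; apply HV.
    assert (E : c * cos alpha = (m * t + c) * cos alpha - t * sin alpha)
      by (rewrite <- Hm; ring).
    assert (rho ^ 2 <= (c * cos alpha) ^ 2).
    { rewrite <- (pow2_abs (c * cos alpha)); apply pow_incr; lra. }
    (* Lagrange's identity for the point [(t, m t + c)] and the unit vector at angle [alpha]. *)
    assert (L : (t ^ 2 + (m * t + c) ^ 2) * (cos alpha ^ 2 + sin alpha ^ 2) =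
              (c * cos alpha) ^ 2 + (t * cos alpha + (m * t + c) * sin alpha) ^ 2)
      by (rewrite E; ring).
    rewrite cos2_sin2 in L.
    pose proof (pow2_ge_0 (t * cos alpha + (m * t + c) * sin alpha)); lra.
Qed.

(** * The theorem *)

Lemma vanishes_outside_of_support (h : R * R -> R) (rho : R) :
  (forall p, support h p -> disk rho p) ->
  vanishes_outside rho (fun x y => h (x, y)).
Proof.
  intros Hs x y Hxy.
  destruct (Req_dec (h (x, y)) 0) as [|Hne]; [assumption|exfalso].
  assert (D : disk rho (x, y)).
  { apply Hs; intros U HU; exists (x, y); split; [|exact Hne].
    now apply locally_singleton. }
  unfold disk in D; simpl fst in D; simpl snd in D.
  apply sqrt_le_1_alt in Hxy.
  rewrite <- (Rsqr_pow2 rho), sqrt_Rsqr_abs in Hxy.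
  pose proof (Rle_abs rho); lra.
Qed.

Lemma C1_in_y_of_smooth (h : R * R -> R) :
  smooth h -> C1_in_y (fun x y => h (x, y)).
Proof.
  intros Hs; split.
  - intros x y; apply (continuity_2d_pt_filterlim (fun a b => h (a, b))), (Hs 0%nat x y).
  - exists (fun x y => Derive (fun v => h (x, v)) y); split.
    + intros x y.
      apply (continuity_2d_pt_filterlim (fun a b => Derive (fun v => h (a, v)) b)).
      now destruct (Hs 1%nat x y) as (_ & _ & _ & _ & ? & _).
    + intros x y; apply Derive_correct; now destruct (Hs 1%nat x y) as (_ & _ & ? & _).
Qed.

Theorem theorem3p1 :
  forall (Rad theta : R),
    0 < Rad ->
    0 < theta < PI / 2 ->
    forall f g : R * R -> R * R,
      admissible_field (Rad * sin theta) f ->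
      admissible_field (Rad * sin theta) g ->
      (forall beta d : R,
          0 <= beta < 2 * PI ->
          0 <= d <= 2 * Rad ->
          L_transform Rad theta f beta d = L_transform Rad theta g beta d /\
          T_transform Rad theta f beta d = T_transform Rad theta g beta d) ->
      forall p : R * R, f p = g p.
Proof.
  intros Rad theta HRad Hth f g
    [[Sf1 _] [[Sf2 _] [Uf1 Uf2]]] [[Sg1 _] [[Sg2 _] [Ug1 Ug2]]] Hdata.
  apply C1_in_y_of_smooth in Sf1, Sf2, Sg1, Sg2.
  apply vanishes_outside_of_support in Uf1, Uf2, Ug1, Ug2.
  change (C1_in_y (comp1 f)) in Sf1; change (C1_in_y (comp2 f)) in Sf2.
  change (C1_in_y (comp1 g)) in Sg1; change (C1_in_y (comp2 g)) in Sg2.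
  change (vanishes_outside (Rad * sin theta) (comp1 f)) in Uf1.
  change (vanishes_outside (Rad * sin theta) (comp2 f)) in Uf2.
  change (vanishes_outside (Rad * sin theta) (comp1 g)) in Ug1.
  change (vanishes_outside (Rad * sin theta) (comp2 g)) in Ug2.
  destruct (admissible_radius Rad theta HRad Hth) as [Hrho HrhoR].
  assert (Z : zero_data Rad theta (lincomb 1 (-1) (comp1 f) (comp1 g))
                                  (lincomb 1 (-1) (comp2 f) (comp2 g))).
  { intros beta d Hb Hd A B.
    destruct (Hdata beta d Hb Hd) as [EL ET].
    rewrite !(L_transform_as_branches (Rad * sin theta)) in EL
      by (first [apply Sf1|apply Sf2|apply Sg1|apply Sg2|assumption|lra]).
    rewrite !(T_transform_as_branches (Rad * sin theta)) in ET
      by (first [apply Sf1|apply Sf2|apply Sg1|apply Sg2|assumption|lra]).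
    unfold A, B, incoming, outgoing.
    rewrite !line_integral_lincomb by (first [apply Sf1|apply Sf2|apply Sg1|apply Sg2]).
    unfold dot, incoming, outgoing in *; simpl fst in *; simpl snd in *; split; lra. }
  assert (S1 : C1_in_y (lincomb 1 (-1) (comp1 f) (comp1 g))) by now apply C1_in_y_lincomb.
  assert (S2 : C1_in_y (lincomb 1 (-1) (comp2 f) (comp2 g))) by now apply C1_in_y_lincomb.
  assert (U1 : vanishes_outside (Rad * sin theta) (lincomb 1 (-1) (comp1 f) (comp1 g)))
    by now apply vanishes_outside_lincomb.
  assert (U2 : vanishes_outside (Rad * sin theta) (lincomb 1 (-1) (comp2 f) (comp2 g)))
    by now apply vanishes_outside_lincomb.
  destruct (full_lines_vanish Rad theta _ _ HRad (proj1 S1) (proj1 S2) U1 U2 Z) as [L1 L2].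
  assert (N1 := zero_of_vanishing_line_integrals _ _ Hrho S1 U1
                  (slope_lines_vanish Rad theta _ HRad Hth (proj1 S1) U1 L1)).
  assert (N2 := zero_of_vanishing_line_integrals _ _ Hrho S2 U2
                  (slope_lines_vanish Rad theta _ HRad Hth (proj1 S2) U2 L2)).
  intros [x y]; rewrite (surjective_pairing (f (x, y))), (surjective_pairing (g (x, y))).
  specialize (N1 x y); specialize (N2 x y).
  unfold lincomb, comp1, comp2 in N1, N2.
  f_equal; lra.
Qed.
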